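(* Let $j\in\{1,2,3,4\}$, $\lambda\in\{1,-1\}$, and let $\mathfrak{C}^{\{j;\lambda\}}(s,t,w)$ be the canal hypersurface in $E_1^4$ $$\mathfrak{C}^{\{j;\lambda\}}=\beta-\lambda\varepsilon_1 rr'F_1+ r\sqrt{r'^2-\lambda\varepsilon_1}\,\sum_{i=2}^{4}\mathfrak{a}_iF_i,\qquad r'(s)^2>\lambda\varepsilon_1 .$$ Then $\mathfrak{C}^{\{j;\lambda\}}$ is minimal if and only if $k_1=0$ and the radius $r(s)$ satisfies $$\int\frac{dr}{\sqrt{\varepsilon_1\lambda+\left(\frac{c_1}{r}\right)^{4/3}}}=\pm s+c_2,\qquad c_1,c_2\in\mathbb{R}.$$
   Context: $E_1^4$ is $\mathbb{R}^4$ with the inner product $g(x,y)=\langle x,y\rangle=-x_1y_1+x_2y_2+x_3y_3+x_4y_4$. $\beta:I\to E_1^4$ ($I$ an open interval) is a smooth unit-speed curve with smooth Frenet frame $F_1=\beta',F_2,F_3,F_4$, pairwise orthogonal, $g(F_i,F_i)=\varepsilon_i$, where $\varepsilon_j=-1$ and $\varepsilon_i=1$ for $i\neq j$. The Frenet equations are $$F_1'=k_1F_2,\quad F_2'=\varepsilon_3\varepsilon_4k_1F_1+k_2F_3,\quad F_3'=\varepsilon_1\varepsilon_4k_2F_2+k_3F_4,\quad F_4'=\varepsilon_1\varepsilon_2k_3F_3,$$ with smooth functions $k_1,k_2,k_3$ on $I$ (allowed to vanish). The radius function $r:I\to(0,\infty)$ is smooth. The functions $\mathfrak{a}_i(t,w)$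 are: for $j=1$: $\mathfrak{a}_2=\cos t\cos w$, $\mathfrak{a}_3=\sin t\cos w$, $\mathfrak{a}_4=\sin w$; for $j=2$: $\mathfrak{a}_2=\cosh t\cosh w$, $\mathfrak{a}_3=\sinh w$, $\mathfrak{a}_4=\sinh t\cosh w$; for $j=3$: $\mathfrak{a}_2=\sinh t\cosh w$, $\mathfrak{a}_3=\cosh t\cosh w$, $\mathfrak{a}_4=\sinh w$; for $j=4$: $\mathfrak{a}_2=\sinh w$, $\mathfrak{a}_3=\sinh t\cosh w$, $\mathfrak{a}_4=\cosh t\cosh w$. The parameters range over $(s,t,w)\in I\times W$ with $W\subseteq\mathbb{R}^2$ nonempty and open, and the hypersurface is assumed regular there, i.e. $\det[g_{ik}]\neq0$. For a parametrized hypersurface $\Gamma(u_1,u_2,u_3)$ with unit normal field $N$: $g_{ik}=\langle\Gamma_{u_i},\Gamma_{u_k}\rangle$, $h_{ik}=\langle\Gamma_{u_iu_k},N\rangle$, $S=[g_{ik}]^{-1}[h_{ik}]$, and the mean curvature $H$ is defined by $3\varepsilon H=\operatorname{tr}(S)$ with $\varepsilon=\langle N,N\rangle$. Here $(u_1,u_2,u_3)=(s,t,w)$. Minimal means $H$ vanishes identically. ''$k_1=0$'' means $k_1$ vanishes identically on $I$. The left-hand side of the integral relation denotes an antiderivative, in the variable $r$, of the displayed integrand, evaluated at $r=r(s)$; $c_1,c_2$ are constants.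
   Formalization: The sign ± and c_2 are chosen separately on each open subinterval of I where r is monotone (c_1 and the antiderivative are common): for ε_1λ=-1 the radius of a minimal hypersurface may have an interior maximum, where the integrand is undefined and the sign switches. *)

(* Defs.v *)
From mathcomp Require Import all_boot all_order all_algebra.
From mathcomp Require Import all_classical all_reals all_analysis.

Set Implicit Arguments.
Unset Strict Implicit.
Unset Printing Implicit Defensive.

Import Order.TTheory GRing.Theory Num.Theory.
Import numFieldNormedType.Exports.
Local Open Scope ring_scope.
Local Open Scope classical_set_scope.

Definition cosh (R : realType) (x : R) : R := (expR x + expR (- x)) / 2.
Definition sinh (R : realType) (x : R) : R := (expR x - expR (- x)) / 2.

Definition open_interval (R : realType) (I : set R) : Prop :=
  [/\ I !=set0, open I & is_interval I].

(* As [I] is always open below, the derivatives at points of [I] do not depend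
   on the values of the total function [f] outside [I]. *)
Definition smooth_on (R : realType) (V : normedModType R) (I : set R)
    (f : R -> V) : Prop :=
  forall n s, I s -> derivable (derive1n n f) s 1.

(* The time coordinate is the one of index 0. *)
Definition lorentz (R : realType) (x y : 'rV[R]_4) : R :=
  \sum_(i < 4) (if i == 0 then -1 else 1) * (x 0 i * y 0 i).

(* Frame vectors, signs and the coefficients a_i are indexed by 1, ..., 4;
   values at other natural numbers are never used. *)
Definition eps (R : realType) (j i : nat) : R := if i == j then -1 else 1.
Arguments eps {R} j i.

Record frenet_curve (R : realType) (j : nat) (I : set R)
    (beta : R -> 'rV[R]_4) (F : nat -> R -> 'rV[R]_4) (k1 k2 k3 : R -> R) :
    Prop := FrenetCurve {
  curve_smooth : smooth_on I beta;
  frame_smooth : forall i, (1 <= i <= 4)%N -> smooth_on I (F i);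
  curvatures_smooth : [/\ smooth_on I k1, smooth_on I k2 & smooth_on I k3];
  frame_tangent : forall s, I s -> F 1%N s = derive1 beta s;
  frame_norm : forall i s, (1 <= i <= 4)%N -> I s ->
    lorentz (F i s) (F i s) = eps j i;
  frame_orthogonal : forall i k s, (1 <= i <= 4)%N -> (1 <= k <= 4)%N ->
    i != k -> I s -> lorentz (F i s) (F k s) = 0;
  frenet1 : forall s, I s -> derive1 (F 1%N) s = k1 s *: F 2%N s;
  frenet2 : forall s, I s ->
    derive1 (F 2%N) s = (eps j 3 * eps j 4 * k1 s) *: F 1%N s + k2 s *: F 3%N s;
  frenet3 : forall s, I s ->
    derive1 (F 3%N) s = (eps j 1 * eps j 4 * k2 s) *: F 2%N s + k3 s *: F 4%N s;
  frenet4 : forall s, I s ->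
    derive1 (F 4%N) s = (eps j 1 * eps j 2 * k3 s) *: F 3%N s
}.

Definition acoef (R : realType) (j i : nat) (t w : R) : R :=
  match j, i with
  | 1%N, 2%N => cos t * cos w
  | 1%N, 3%N => sin t * cos w
  | 1%N, 4%N => sin w
  | 2%N, 2%N => cosh t * cosh w
  | 2%N, 3%N => sinh w
  | 2%N, 4%N => sinh t * cosh w
  | 3%N, 2%N => sinh t * cosh w
  | 3%N, 3%N => cosh t * cosh w
  | 3%N, 4%N => sinh w
  | 4%N, 2%N => sinh w
  | 4%N, 3%N => sinh t * cosh w
  | 4%N, 4%N => cosh t * cosh w
  | _, _ => 0
  end.

(* The parameter point (s, t, w) is the row vector [u]. *)
Definition canal (R : realType) (j : nat) (lam : R) (beta : R -> 'rV[R]_4)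
    (F : nat -> R -> 'rV[R]_4) (r : R -> R) (u : 'rV[R]_3) : 'rV[R]_4 :=
  let s := u 0 0 in let t := u 0 1 in let w := u 0 2 in
  beta s - (lam * eps j 1 * r s * derive1 r s) *: F 1%N s
  + (r s * Num.sqrt ((derive1 r s) ^+ 2 - lam * eps j 1)) *:
      \sum_(2 <= i < 5) acoef j i t w *: F i s.

Definition param_domain (R : realType) (I : set R) (W : set (R * R)) :
    set 'rV[R]_3 :=
  [set u | I (u 0 0) /\ W (u 0 1, u 0 2)].

Section Hypersurface.
Variables (R : realType) (G N : 'rV[R]_3 -> 'rV[R]_4).

Definition partial (H : 'rV[R]_3 -> 'rV[R]_4) (i : 'I_3) :
    'rV[R]_3 -> 'rV[R]_4 := fun u => 'D_(delta_mx 0 i) H u.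

Definition first_form (u : 'rV[R]_3) : 'M[R]_3 :=
  \matrix_(i, k) lorentz (partial G i u) (partial G k u).

Definition second_form (u : 'rV[R]_3) : 'M[R]_3 :=
  \matrix_(i, k) lorentz (partial (partial G i) k u) (N u).

Definition shape_operator (u : 'rV[R]_3) : 'M[R]_3 :=
  invmx (first_form u) *m second_form u.

Definition mean_curvature (u : 'rV[R]_3) : R :=
  \tr (shape_operator u) / (3 * lorentz (N u) (N u)).

Definition regular_on (D : set 'rV[R]_3) : Prop :=
  forall u, D u -> \det (first_form u) != 0.

Definition unit_normal_on (D : set 'rV[R]_3) : Prop :=
  forall u, D u -> `|lorentz (N u) (N u)| = 1 /\
    forall i, lorentz (partial G i u) (N u) = 0.

Definition minimal_on (D : set 'rV[R]_3) : Prop :=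
  forall u, D u -> mean_curvature u = 0.

End Hypersurface.

Section RadiusRelation.
Variables (R : realType) (e c1 : R).

(* (c1 / x)^(4/3) is the cube root of (c1 / x)^4, defined for c1 of any sign;
   [powR] is only meaningful on nonnegative bases, hence the absolute value. *)
Definition radicand (x : R) : R := e + `|c1 / x| `^ (4 / 3).

Definition integrand (x : R) : R := 1 / Num.sqrt (radicand x).

Definition integrand_dom : set R := [set x | 0 < x /\ 0 < radicand x].

Definition is_antiderivative (Phi : R -> R) : Prop :=
  forall x, integrand_dom x -> is_derive x 1 Phi (integrand x).

End RadiusRelation.

Definition monotone_on (R : realType) (J : set R) (r : R -> R) : Prop :=
  (forall x y, J x -> J y -> x <= y -> r x <= r y) \/
  (forall x y, J x -> J y -> x <= y -> r y <= r x).

(* The relation  int dr / sqrt (e + (c1/r)^(4/3)) = +- s + c2.  When e = -1 a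
   solution r may have an interior maximum, where r = |c1|, the integrand blows
   up and the sign +- switches.  So the sign and c2 are those of a branch, i.e.
   an open interval on which r is monotone, while c1 and the antiderivative are
   common to all branches.  If r is monotone on I (always the case when
   r'^2 > e = 1), taking J = I gives one sign and one c2.  A constant r never
   satisfies the relation, since a constant is not of the form +- s + c2. *)
Definition integral_relation (R : realType) (e : R) (I : set R) (r : R -> R) :
    Prop :=
  exists c1 : R, exists2 Phi : R -> R, is_antiderivative e c1 Phi &
    forall J : set R, open_interval J -> J `<=` I -> monotone_on J r ->
      exists sigma c2 : R, (sigma = 1 \/ sigma = -1) /\
        forall s, J s -> integrand_dom e c1 (r s) /\ Phi (r s) = sigma * s + c2.

(* Main.v *)
Require Import Defs.
From mathcomp Require Import all_boot all_order all_algebra.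
From mathcomp Require Import all_classical all_reals all_analysis.
From mathcomp Require Import measurable_realfun.
From mathcomp Require Import ring lra.

Set Implicit Arguments.
Unset Strict Implicit.
Unset Printing Implicit Defensive.

Import Order.TTheory GRing.Theory Num.Theory.
Import numFieldNormedType.Exports.
Local Open Scope ring_scope.
Local Open Scope classical_set_scope.

(** The hypersurface is the envelope of the pseudo-spheres of radius [r s]
    centred on the curve, so it is [C = beta + r n] where [n] is a unit normal:
    the explicit formula yields [<n, n> = lam] and [<n, F_1> = - lam r'].  These
    two products and [<n, F_2>] determine the mean curvature, whatever the
    functions [a_i] are.  Write [mu = lam * eps j 1].

    With respect to [n], two principal curvatures are [- 1 / r], in the
    directions of [t] and [w], and the third one belongs to the direction of
    [T = F_1 + r' n].  In matrix form, with [g] and [h] the two fundamental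
    forms, [r h + g] has a single nonzero entry, [m = <C_s, T>]
    ([canal_second_form]); as [g^-1] has the entry [<T, T> / m^2] at the same
    place ([gram_inv00]), the trace of [g^-1 h] vanishes if and only if
    [<T, T> = 3 m] ([trace_inv_gram]).  Computing [m] by differentiating the
    products above, one finds that this is
      [3 r r'' + 2 (r'^2 - mu) + 3 lam eps_2 r k1 sqrt (r'^2 - mu) a_2 = 0]
    ([canal_mean_curvature_eq0]).  Since [a_2] is not constant on an open set of
    parameters ([acoef2_not_constant]), minimality amounts to [k1 = 0] together
    with the equation [3 r r'' + 2 (r'^2 - mu) = 0] ([minimal_canalP]).

    This equation has the first integral [(r'^2 - mu)^3 r^4 = c^4], that is
    [r' = +- sqrt (mu + (c / r)^(4/3))], which after separation of variables is
    the integral relation.  In one direction the antiderivative is an integral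
    from 0 ([antiderivative_exists]) and [r'] is shown not to vanish on a branch
    ([radius_ode_integral_relation]).  In the other one the equation comes from
    differentiating the relation where [r' <> 0], and by continuity elsewhere
    ([integral_relation_radius_ode]). *)

(** * The Lorentz form and nondegenerate frames *)

Section LorentzForm.
Context {R : realType}.
Implicit Types x y z : 'rV[R]_4.

Definition minkowski : 'M[R]_4 :=
  diag_mx (\row_i if i == 0 then -1 else 1).

Lemma lorentz_mx m1 m2 (A : 'M[R]_(m1, 4)) (B : 'M[R]_(m2, 4)) i k :
  (A *m minkowski *m B^T) i k = lorentz (row i A) (row k B).
Proof.
rewrite mxE; apply: eq_bigr => l _.
by rewrite mul_mx_diag !mxE; ring.
Qed.

Lemma lorentzC x y : lorentz x y = lorentz y x.
Proof. by apply: eq_bigr => i _; rewrite (mulrC (x 0 i)). Qed.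

Lemma lorentzDl x y z : lorentz (x + y) z = lorentz x z + lorentz y z.
Proof. by rewrite -big_split; apply: eq_bigr => i _; rewrite !mxE /=; ring. Qed.

Lemma lorentzZl a x y : lorentz (a *: x) y = a * lorentz x y.
Proof. by rewrite big_distrr; apply: eq_bigr => i _; rewrite !mxE /=; ring. Qed.

Lemma lorentzDr x y z : lorentz x (y + z) = lorentz x y + lorentz x z.
Proof. by rewrite lorentzC lorentzDl !(lorentzC x). Qed.

Lemma lorentzZr a x y : lorentz x (a *: y) = a * lorentz x y.
Proof. by rewrite lorentzC lorentzZl lorentzC. Qed.

Lemma lorentzBr x y z : lorentz x (y - z) = lorentz x y - lorentz x z.
Proof. by rewrite -scaleN1r lorentzDr lorentzZr mulN1r. Qed.

Lemma lorentz_sumr n (a : 'I_n -> R) (X : 'I_n -> 'rV[R]_4) y :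
  lorentz y (\sum_i a i *: X i) = \sum_i a i * lorentz y (X i).
Proof.
elim/big_ind2: _ => [|u u' v v' <- <-|i _]; last by rewrite lorentzZr.
  by rewrite -(scale0r 0) lorentzZr mul0r.
by rewrite lorentzDr.
Qed.

Definition gram (X : 'I_3 -> 'rV[R]_4) : 'M[R]_3 :=
  \matrix_(i, k) lorentz (X i) (X k).

(** Tangent vectors with invertible Gram matrix, completed by a non-null normal
    [n], form a basis: the Gram matrix of the four vectors is block diagonal,
    with determinant [\det (gram X) * lorentz n n], so the matrix of their
    coordinates is invertible and only 0 is orthogonal to all of them. *)
Lemma lorentz_frame_eq0 (X : 'I_3 -> 'rV[R]_4) n y :
  \det (gram X) != 0 -> lorentz n n != 0 ->
  (forall i, lorentz (X i) n = 0) ->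
  (forall i, lorentz (X i) y = 0) -> lorentz n y = 0 -> y = 0.
Proof.
move=> dG n0 Xn Xy ny.
pose B : 'M[R]_(3 + 1, 4) := col_mx (\matrix_i X i) n.
have rowl i : row (lshift 1 i) B = X i by rewrite rowKu rowK.
have rowr i : row (rshift 3 i) B = n by rewrite rowKd ord1 row_id.
have BB : B *m minkowski *m B^T =
    block_mx (gram X) 0 0 (lorentz n n)%:M.
  apply/matrixP => i k; rewrite lorentz_mx.
  case: (split_ordP i) => {}i ->; case: (split_ordP k) => {}k ->;
    rewrite ?rowl ?rowr ?block_mxEul ?block_mxEur ?block_mxEdl ?block_mxEdr.
  - by rewrite mxE.
  - by rewrite Xn mxE.
  - by rewrite lorentzC Xn mxE.
  - by rewrite !ord1 mxE eqxx.
have uB : B *m minkowski \in unitmx.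
  have : \det (B *m minkowski *m B^T) != 0.
    by rewrite BB det_ublock det_scalar1 mulf_neq0.
  by rewrite det_mulmx mulf_eq0 negb_or unitmxE unitfE => /andP[].
have By : B *m minkowski *m y^T = 0.
  apply/matrixP => i k; rewrite lorentz_mx [RHS]mxE (ord1 k) row_id.
  by case: (split_ordP i) => {}i ->; rewrite ?rowl ?rowr.
by apply: trmx_inj; rewrite -(mulKmx uB y^T) By mulmx0 trmx0.
Qed.

(** When [m] is nonzero, [T / m] is the vector dual to [X 0] in the basis dual
    to [X], whose Gram matrix is the inverse of that of [X].  This gives an
    entry of the inverse without computing any cofactor. *)
Lemma gram_inv00 (X : 'I_3 -> 'rV[R]_4) n T m :
  \det (gram X) != 0 -> lorentz n n != 0 ->
  (forall i, lorentz (X i) n = 0) -> lorentz T n = 0 ->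
  (forall i, lorentz (X i) T = m *+ (i == 0)) ->
  lorentz T T = m ^+ 2 * invmx (gram X) 0 0.
Proof.
move=> dG n0 Xn Tn XT.
have uG : gram X \in unitmx by rewrite unitmxE unitfE.
(* [T], being orthogonal to [n], is a combination of [X]: its coordinates *)
pose v : 'rV[R]_3 := m *: row 0 (invmx (gram X)).
have vG : v *m gram X = m *: delta_mx 0 0.
  by rewrite -scalemxAl -row_mul mulVmx// rowE mulmx1.
have TE : T = \sum_i v 0 i *: X i.
  apply/eqP; rewrite -subr_eq0; apply/eqP.
  apply: (@lorentz_frame_eq0 X n) => // [i|]; rewrite lorentzBr lorentz_sumr.
    have := congr1 (fun M : 'rV_3 => M 0 i) vG; rewrite !mxE XT eqxx /= => vGi.
    rewrite -mulr_natr -vGi; apply/eqP; rewrite subr_eq0; apply/eqP.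
    by apply: eq_bigr => k _; rewrite [gram X k i]mxE (lorentzC (X k)).
  rewrite lorentzC Tn big1 ?subr0// => i _.
  by rewrite lorentzC Xn mulr0.
rewrite {2}TE lorentz_sumr (bigD1 0)//= big1 ?addr0 => [|i /negPf i0].
  by rewrite lorentzC XT eqxx !mxE expr2 /=; ring.
by rewrite lorentzC XT i0 mulr0.
Qed.

(** Here [h] is the second fundamental form.  The hypothesis on [h] says that
    the shape operator is [- r^-1] up to a rank one term carried by the first
    coordinate; it is what being an envelope of spheres of radius [r] gives.
    The trace then only involves the entry computed in [gram_inv00]. *)
Lemma trace_inv_gram (X : 'I_3 -> 'rV[R]_4) n T m r (h : 'M[R]_3) :
  \det (gram X) != 0 -> lorentz n n != 0 ->
  (forall i, lorentz (X i) n = 0) -> lorentz T n = 0 ->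
  (forall i, lorentz (X i) T = m *+ (i == 0)) ->
  r *: h + gram X = m *: delta_mx 0 0 ->
  lorentz T T - 3 * m = r * m * \tr (invmx (gram X) *m h).
Proof.
move=> dG n0 Xn Tn XT hE.
have uG : gram X \in unitmx by rewrite unitmxE unitfE.
have : \tr (invmx (gram X) *m (r *: h + gram X)) =
       \tr (invmx (gram X) *m (m *: delta_mx 0 0)) by rewrite hE.
rewrite mulmxDr mulVmx// mxtraceD mxtrace1 -!scalemxAr !mxtraceZ.
have -> : \tr (invmx (gram X) *m delta_mx 0 0) = invmx (gram X) 0 0.
  rewrite /mxtrace (bigD1 0)//= big1 ?addr0 => [|i i0].
    rewrite mxE (bigD1 0)//= big1 ?addr0 => [|k k0]; rewrite mxE ?eqxx ?mulr1//.
    by rewrite (negPf k0) mulr0.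
  by rewrite mxE big1// => k _; rewrite mxE (negPf i0) andbF mulr0.
rewrite (gram_inv00 dG n0 Xn Tn XT) => E.
set t := \tr _ in E *.
have -> : r * m * t = m * (r * t) by ring.
have -> : r * t = m * invmx (gram X) 0 0 - 3 by rewrite -E addrK.
ring.
Qed.

End LorentzForm.

(** * Partial derivatives *)

Section PartialDerivatives.
Context {R : realType}.
Implicit Types (D : set 'rV[R]_3) (u : 'rV[R]_3).

Lemma open_near_eq (V W : normedModType R) (D : set V) (f g : V -> W) (u : V) :
  open D -> (forall v, D v -> f v = g v) -> D u -> \forall v \near u, f v = g v.
Proof. by move=> oD fg Du; apply: filterS fg _; exact: open_nbhs_nbhs. Qed.

(** A directional derivative only depends on the restriction to a line; the
    shift by [c] lets the line be parametrized by a coordinate of [u]. *)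
Lemma is_derive_slice (V W : normedModType R) (f : V -> W) (u v : V) (c : R)
   (df : W) :
  is_derive c 1 (fun x : R => f (u + (x - c) *: v)) df -> is_derive u v f df.
Proof.
pose g (x : R) := f (u + (x - c) *: v).
have E : (fun h : R => h^-1 *: ((g \o shift c) (h *: 1) - g c)) =
         (fun h => h^-1 *: ((f \o shift u) (h *: v) - f u)).
  apply/funext => h; rewrite /g /=.
  by rewrite subrr scale0r addr0 addrK [h%:A]mulr1 (addrC u).
by case; rewrite -/g /derivable/derive E => d1 d2; split.
Qed.

Definition derivable2 (I : set R) (V : normedModType R) (f : R -> V) : Prop :=
  forall s, I s -> derivable f s 1 /\ derivable (derive1 f) s 1.

(** The second fundamental form is made of iterated partial derivatives, so it
    is their existence, rather than differentiability of order 2, that has to be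
    propagated. *)
Definition pderivable2 D (V : normedModType R) (f : 'rV[R]_3 -> V) : Prop :=
  forall u (i : 'I_3), D u -> derivable f u (delta_mx 0 i) /\
    forall k : 'I_3, derivable ('D_(delta_mx 0 i) f) u (delta_mx 0 k).

Lemma pderivable2_eq D (V : normedModType R) (f g : 'rV[R]_3 -> V) :
  open D -> (forall u, D u -> f u = g u) -> pderivable2 D f -> pderivable2 D g.
Proof.
move=> oD fg df u i Du; have [dfu d2f] := df u i Du; split.
  by apply: near_eq_derivable dfu; exact: (open_near_eq oD).
move=> k; apply: near_eq_derivable (d2f k).
apply: (open_near_eq oD) Du => v Dv; apply: near_eq_derive.
exact: (open_near_eq oD).
Qed.

Lemma pderivable2D D (f g : 'rV[R]_3 -> R) : open D ->
  pderivable2 D f -> pderivable2 D g -> pderivable2 D (f + g).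
Proof.
move=> oD df dg u i Du.
have [df1 df2] := df u i Du; have [dg1 dg2] := dg u i Du.
split; first exact: (derivableD df1 dg1).
move=> k; apply: near_eq_derivable (derivableD (df2 k) (dg2 k)).
apply: (open_near_eq oD) Du => v Dv.
by rewrite (deriveD (df v i Dv).1 (dg v i Dv).1).
Qed.

Lemma pderivable2M D (f g : 'rV[R]_3 -> R) : open D ->
  pderivable2 D f -> pderivable2 D g -> pderivable2 D (f * g).
Proof.
move=> oD df dg u i Du.
have [df1 df2] := df u i Du; have [dg1 dg2] := dg u i Du.
split; first exact: (derivableM df1 dg1).
move=> k; have [df1k _] := df u k Du; have [dg1k _] := dg u k Du.
apply: near_eq_derivable
  (derivableD (derivableM df1k (dg2 k)) (derivableM dg1k (df2 k))).
apply: (open_near_eq oD) Du => v Dv.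
by rewrite (deriveM (df v i Dv).1 (dg v i Dv).1).
Qed.

Lemma is_derive_coord (V : normedModType R) (f : R -> V) (k i : 'I_3) u :
  derivable f (u 0 k) 1 ->
  is_derive u (delta_mx 0 i) (fun v => f (v 0 k))
    (derive1 f (u 0 k) *+ (k == i)).
Proof.
move=> df; apply: (@is_derive_slice _ _ _ _ _ (u 0 k)); move: df.
case: (eqVneq k i) => [->|ki] df; last first.
  have -> : (fun x : R => f ((u + (x - u 0 k) *: delta_mx 0 i) 0 k)) =
      cst (f (u 0 k)).
    by apply/funext => x; rewrite !mxE (negPf ki) andbF mulr0 addr0.
  exact: is_derive_cst.
have -> : (fun x : R => f ((u + (x - u 0 i) *: delta_mx 0 i) 0 i)) = f.
  by apply/funext => x; rewrite !mxE !eqxx mulr1 subrKC.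
by rewrite derive1E; exact: derivableP.
Qed.

Lemma pderivable2_coord D (I : set R) (f : R -> R) (k : 'I_3) : open D ->
  (forall u, D u -> I (u 0 k)) -> derivable2 I f ->
  pderivable2 D (fun u => f (u 0 k)).
Proof.
move=> oD DI df u i Du; have [df1 df2] := df _ (DI _ Du).
split; first by have [] := is_derive_coord i df1.
move=> l; have [d _] := is_derive_coord l df2.
have dn : derivable (fun v : 'rV[R]_3 => (k == i)%:R * derive1 f (v 0 k)) u
    (delta_mx 0 l).
  exact: (@derivableZ _ _ _ _ (k == i)%:R _ _ d).
apply: near_eq_derivable dn; apply: (open_near_eq oD) Du => v Dv.
have [dv _] := df _ (DI _ Dv).
by rewrite mulr_natl; have [_ ->] := is_derive_coord i dv.
Qed.

Lemma pderivable2_mx D (f : 'rV[R]_3 -> 'rV[R]_4) : open D ->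
  (forall l, pderivable2 D (fun u => f u 0 l)) -> pderivable2 D f.
Proof.
move=> oD df.
have d1 u i : D u -> derivable f u (delta_mx 0 i).
  move=> Du; apply/derivable_mxP => a l; rewrite ord1.
  by have [] := df l u i Du.
move=> u i Du; split; first exact: d1.
move=> k; apply/derivable_mxP => a l; rewrite ord1.
have [_ /(_ k)] := df l u i Du; apply: near_eq_derivable.
by apply: (open_near_eq oD) Du => v Dv; rewrite derive_mx ?mxE//; exact: d1.
Qed.

Lemma is_derive_entry (f : 'rV[R]_3 -> 'rV[R]_4) u v l :
  derivable f u v -> is_derive u v (fun x => f x 0 l) ('D_v f u 0 l).
Proof.
move=> df; have /derivable_mxP/(_ 0 l)/derivableP := df.
by rewrite (derive_mx df) mxE.
Qed.

Lemma is_derive_scale (f : 'rV[R]_3 -> R) (g : 'rV[R]_3 -> 'rV[R]_4) u v df :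
  is_derive u v f df -> derivable g u v ->
  is_derive u v (fun x => f x *: g x) (df *: g u + f u *: 'D_v g u).
Proof.
move=> dfu dg.
have gl l := is_derive_entry l dg.
have fgl l : is_derive u v (fun x => (f x *: g x) 0 l)
    (f u * 'D_v g u 0 l + g u 0 l * df).
  have -> : (fun x => (f x *: g x) 0 l) = f * (fun x => g x 0 l).
    by apply/funext => x; rewrite mxE.
  exact: is_deriveM.
have d : derivable (fun x => f x *: g x) u v.
  by apply/derivable_mxP => a l; rewrite ord1; have [] := fgl l.
split=> //; rewrite derive_mx//; apply/rowP => l; rewrite !mxE.
by have [_ ->] := fgl l; rewrite addrC (mulrC df).
Qed.

Lemma is_derive_lorentz (f g : 'rV[R]_3 -> 'rV[R]_4) u v :
  derivable f u v -> derivable g u v ->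
  is_derive u v (fun x => lorentz (f x) (g x))
    (lorentz ('D_v f u) (g u) + lorentz (f u) ('D_v g u)).
Proof.
move=> df dg.
have fl l := is_derive_entry l df.
have gl l := is_derive_entry l dg.
pose sg (l : 'I_4) : R := if l == 0 then -1 else 1.
have -> : (fun x => lorentz (f x) (g x)) =
   \sum_(l < 4) (sg l *: ((fun x => f x 0 l) * (fun x => g x 0 l))).
  by apply/funext => x; rewrite fct_sumE.
have dfg l := is_deriveZ (sg l) (is_deriveM (fl l) (gl l)).
apply: (is_derive_eq (is_derive_sum dfg)).
rewrite -big_split; apply: eq_bigr => l _ /=.
by rewrite /GRing.scale/= -/(sg l); ring.
Qed.

End PartialDerivatives.

(** * The functions entering the parametrization *)

Section CanalRegularity.
Context {R : realType}.
Implicit Types (I : set R) (s x : R).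

Lemma smooth_derivable2 I (V : normedModType R) (f : R -> V) n :
  smooth_on I f -> derivable2 I (derive1n n f).
Proof.
by move=> df s Is; split; [exact: df|rewrite -derive1nS; exact: df].
Qed.

Lemma derivable2_entry I (f : R -> 'rV[R]_4) (l : 'I_4) :
  open I -> derivable2 I f -> derivable2 I (fun s => f s 0 l).
Proof.
move=> oI df s Is; have [d1 d2] := df s Is.
split; first by have /derivable_mxP := d1.
have /derivable_mxP/(_ 0 l) := d2; apply: near_eq_derivable.
apply: (open_near_eq oI) Is => x Ix.
by rewrite !derive1E (derive_mx (df x Ix).1) mxE.
Qed.

Lemma derivable2_sqrB I (f : R -> R) c : open I ->
  derivable2 I f -> derivable2 I (fun s => f s ^+ 2 - c).
Proof.
move=> oI df.
have d1 s : I s -> is_derive s 1 (fun x => f x ^+ 2 - c)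
    (f s * derive1 f s + f s * derive1 f s).
  move=> Is; have dfs : is_derive s 1 f (derive1 f s).
    by rewrite derive1E; exact: derivableP (df s Is).1.
  have := is_deriveB (is_deriveM dfs dfs) (is_derive_cst c s 1).
  by rewrite subr0.
move=> s Is; split; first by have [] := d1 s Is.
have dff := derivableM (df s Is).1 (df s Is).2.
apply: near_eq_derivable (derivableD dff dff).
apply: (open_near_eq oI) Is => x Ix.
by rewrite [RHS]derive1E; have [_ ->] := d1 x Ix.
Qed.

Lemma derivable2_sqrt I (p : R -> R) : open I -> derivable2 I p ->
  (forall s, I s -> 0 < p s) -> derivable2 I (fun s => Num.sqrt (p s)).
Proof.
move=> oI dp p0.
have d1 s : I s -> is_derive s 1 (fun x => Num.sqrt (p x))
    ((2 * Num.sqrt (p s))^-1 * derive1 p s).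
  move=> Is; apply: is_derive1_comp; first exact: is_derive1_sqrt (p0 _ Is).
  by rewrite derive1E; exact: derivableP (dp s Is).1.
move=> s Is; split; first by have [] := d1 s Is.
have dq : derivable (fun x => 2 * Num.sqrt (p x)) s 1.
  by apply: (@derivableZ _ _ _ _ 2); have [] := d1 s Is.
set q := fun x => 2 * Num.sqrt (p x) in dq.
have q0 : q s != 0 by rewrite mulf_neq0// gt_eqF// sqrtr_gt0 p0.
have dqV : derivable (fun x => (q x)^-1) s 1 := derivableV q0 dq.
apply: near_eq_derivable (derivableM dqV (dp s Is).2).
apply: (open_near_eq oI) Is => x Ix.
by rewrite [RHS]derive1E; have [_ ->] := d1 x Ix.
Qed.

Lemma is_derive_cosh x : is_derive x 1 (@cosh R) (sinh x).
Proof.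
have dN : is_derive x 1 (fun y : R => expR (- y)) (expR (- x) * -1).
  by apply: (@is_derive1_comp _ expR -%R).
have -> : @cosh R = 2^-1 *: (expR + (fun y : R => expR (- y))).
  by apply/funext => y; rewrite /cosh /GRing.scale/= mulrC.
apply: (is_derive_eq (is_deriveZ _ (is_deriveD (is_derive_expR x) dN))).
by rewrite /sinh /GRing.scale/=; ring.
Qed.

Lemma is_derive_sinh x : is_derive x 1 (@sinh R) (cosh x).
Proof.
have dN : is_derive x 1 (fun y : R => expR (- y)) (expR (- x) * -1).
  by apply: (@is_derive1_comp _ expR -%R).
have -> : @sinh R = 2^-1 *: (expR - (fun y : R => expR (- y))).
  by apply/funext => y; rewrite /sinh /GRing.scale/= mulrC.
apply: (is_derive_eq (is_deriveZ _ (is_deriveB (is_derive_expR x) dN))).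
by rewrite /cosh /GRing.scale/=; ring.
Qed.

Lemma derivable2_of_is_derive I (f df ddf : R -> R) :
  (forall s, is_derive s 1 f (df s)) -> (forall s, is_derive s 1 df (ddf s)) ->
  derivable2 I f.
Proof.
move=> d1 d2 s _; split; first by have [] := d1 s.
have -> : derive1 f = df.
  by apply/funext => x; rewrite derive1E; have [_ ->] := d1 x.
by have [] := d2 s.
Qed.

Lemma derivable2_cosh I : derivable2 I (@cosh R).
Proof. exact: derivable2_of_is_derive is_derive_cosh is_derive_sinh. Qed.

Lemma derivable2_sinh I : derivable2 I (@sinh R).
Proof. exact: derivable2_of_is_derive is_derive_sinh is_derive_cosh. Qed.

Lemma derivable2_cos I : derivable2 I (@cos R).
Proof.
by apply: (@derivable2_of_is_derive _ _ (fun s => - sin s)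
  (fun s => - cos s)) => s.
Qed.

Lemma derivable2_sin I : derivable2 I (@sin R).
Proof.
by apply: (@derivable2_of_is_derive _ _ (@cos R) (fun s => - sin s)) => s.
Qed.

Lemma pderivable2_acoef (D : set 'rV[R]_3) (j i : nat) : open D ->
  (1 <= j <= 4)%N -> (2 <= i < 5)%N ->
  pderivable2 D (fun u => acoef j i (u 0 1) (u 0 2)).
Proof.
move=> oD.
have one (f : R -> R) k : derivable2 setT f ->
    pderivable2 D (fun u => f (u 0 k)).
  by move=> df; apply: (@pderivable2_coord _ _ setT).
have two (f g : R -> R) : derivable2 setT f -> derivable2 setT g ->
    pderivable2 D (fun u => f (u 0 1) * g (u 0 2)).
  by move=> df dg; apply: pderivable2M oD (one _ _ df) (one _ _ dg).
have dch := @derivable2_cosh setT; have dsh := @derivable2_sinh setT.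
have dc := @derivable2_cos setT; have ds := @derivable2_sin setT.
case: j => [|[|[|[|[|j]]]]]// _; case: i => [|[|[|[|[|i]]]]]//= _;
  by [exact: one|exact: two].
Qed.

Lemma sum_normal_indices (V : nmodType) (f : nat -> V) :
  \sum_(2 <= i < 5) f i = f 2 + f 3 + f 4.
Proof. by rewrite unlock /= addr0 addrA. Qed.

(** The vectors [sum_i a_i F_i] of the normal space run over a unit quadric: a
    sphere or a hyperboloid according to the causal character of the curve. *)
Lemma acoef_quadric (j : nat) (t w : R) : (1 <= j <= 4)%N ->
  \sum_(2 <= i < 5) eps j i * acoef j i t w ^+ 2 = - eps j 1.
Proof.
have chsh x : cosh x ^+ 2 = 1 + sinh x ^+ 2 :> R.
  have e1 : expR x * expR (- x) = 1 by rewrite expRN divff// gt_eqF// expR_gt0.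
  by rewrite -e1 /cosh /sinh; field.
have cs x : cos x ^+ 2 = 1 - sin x ^+ 2 :> R.
  by rewrite -(cos2Dsin2 x) addrK.
rewrite sum_normal_indices.
by case: j => [|[|[|[|[|j]]]]]// _; rewrite /eps /=;
  ring: (chsh t) (chsh w) (cs t) (cs w).
Qed.

End CanalRegularity.

(** * Curvature of a canal hypersurface *)

Section CanalGeometry.
Context {R : realType}.
Variables (j : nat) (lam : R) (I : set R) (W : set (R * R)).
Variables (beta : R -> 'rV[R]_4) (F : nat -> R -> 'rV[R]_4).
Variables (k1 k2 k3 r : R -> R).
Hypotheses (hj : (1 <= j <= 4)%N) (hlam : lam = 1 \/ lam = -1).
Hypotheses (oI : open I) (oW : open W).
Hypothesis hF : frenet_curve j I beta F k1 k2 k3.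
Hypotheses (hr : smooth_on I r) (hr_gt0 : forall s, I s -> 0 < r s).
Hypothesis hr' : forall s, I s -> lam * eps j 1 < (derive1 r s) ^+ 2.

Local Notation e1 := (@eps R j 1).
Local Notation D := (param_domain I W).

Implicit Types (u : 'rV[R]_3) (s : R) (i k : 'I_3).

Definition profile s : R := Num.sqrt (derive1 r s ^+ 2 - lam * e1).

Definition section_vector u : 'rV[R]_4 :=
  \sum_(2 <= i < 5) acoef j i (u 0 1) (u 0 2) *: F i (u 0 0).

Local Notation q := profile.
Local Notation A := section_vector.

(** The unit vector from the centre [beta s] of the sphere of radius [r s] to
    the point of contact with its envelope, see [canalE]. *)
Definition canal_normal u : 'rV[R]_4 :=
  q (u 0 0) *: A u - (lam * e1 * derive1 r (u 0 0)) *: F 1%N (u 0 0).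

Local Notation n := canal_normal.
Local Notation X := (partial (canal j lam beta F r)).

Lemma open_param_domain : open D.
Proof.
have c k : continuous (fun u : 'rV[R]_3 => u 0 k) by exact: coord_continuous.
have c12 : continuous (fun u : 'rV[R]_3 => (u 0 1, u 0 2)).
  by move=> u; exact: (cvg_pair (c 1 u) (c 2 u)).
have -> : D = (fun u : 'rV[R]_3 => u 0 0) @^-1` I `&`
              (fun u : 'rV[R]_3 => (u 0 1, u 0 2)) @^-1` W by [].
by apply: openI; [exact: (open_comp (fun u _ => c 0 u) oI)|
  exact: (open_comp (fun u _ => c12 u) oW)].
Qed.

Lemma canalE u : canal j lam beta F r u = beta (u 0 0) + r (u 0 0) *: n u.
Proof.
rewrite /canal /canal_normal /= scalerBr !scalerA -/(q _) -/(A u) addrAC -addrA.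
by congr (_ + (_ - _ *: _)); ring.
Qed.

Lemma lam_sqr : lam * lam = 1.
Proof. by case: hlam => ->; rewrite ?mulr1 ?mulrNN ?mulr1. Qed.

Lemma lam_neq0 : lam != 0.
Proof. by case: hlam => ->; rewrite ?oppr_eq0 oner_eq0. Qed.

Lemma eps_sqr (i : nat) : eps j i * eps j i = 1 :> R.
Proof. by rewrite /eps; case: ifP => _; rewrite ?mulrNN mulr1. Qed.

Lemma q_sqr s : I s -> q s ^+ 2 = derive1 r s ^+ 2 - lam * e1.
Proof. by move=> Is; rewrite sqr_sqrtr// subr_ge0 ltW// hr'. Qed.

(** The next lemmas are all that the computation uses of the frame and of the
    functions [acoef]: the products of [A] and of [n] with themselves and with
    [F_1] and [F_2], the only frame vectors in [F_1] and [F_1']. *)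
Lemma lorentz_A1 u : D u -> lorentz (A u) (F 1%N (u 0 0)) = 0.
Proof.
move=> [Is _]; rewrite /section_vector sum_normal_indices !lorentzDl !lorentzZl.
by rewrite !(frame_orthogonal hF _ _ _ Is)// !mulr0 !addr0.
Qed.

Lemma lorentz_A2 u : D u ->
  lorentz (A u) (F 2%N (u 0 0)) = eps j 2 * acoef j 2 (u 0 1) (u 0 2).
Proof.
move=> [Is _]; rewrite /section_vector sum_normal_indices !lorentzDl !lorentzZl.
rewrite (frame_norm hF _ Is)// !(frame_orthogonal hF _ _ _ Is)//.
by rewrite !mulr0 !addr0 mulrC.
Qed.

Lemma lorentz_AA u : D u -> lorentz (A u) (A u) = - e1.
Proof.
move=> [Is _]; rewrite -(acoef_quadric (u 0 1) (u 0 2) hj).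
rewrite /section_vector !sum_normal_indices.
rewrite !lorentzDl !lorentzDr !lorentzZl !lorentzZr.
rewrite !(frame_norm hF _ Is)// !(frame_orthogonal hF _ _ _ Is)//.
ring.
Qed.

Lemma lorentz_nF1 u : D u ->
  lorentz (n u) (F 1%N (u 0 0)) = - (lam * derive1 r (u 0 0)).
Proof.
move=> Du; rewrite lorentzC lorentzBr !lorentzZr lorentzC lorentz_A1//.
rewrite (frame_norm hF _ Du.1)// mulr0 sub0r.
by rewrite -!mulrA (mulrC _ e1) (mulrA e1 e1) eps_sqr mul1r.
Qed.

Lemma lorentz_nF2 u : D u ->
  lorentz (n u) (F 2%N (u 0 0)) =
    q (u 0 0) * (eps j 2 * acoef j 2 (u 0 1) (u 0 2)).
Proof.
move=> Du; rewrite lorentzC lorentzBr !lorentzZr lorentzC lorentz_A2//.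
by rewrite (frame_orthogonal hF _ _ _ Du.1)// mulr0 subr0.
Qed.

Lemma lorentz_nn u : D u -> lorentz (n u) (n u) = lam.
Proof.
move=> Du; rewrite {2}/canal_normal lorentzBr !lorentzZr lorentz_nF1//.
rewrite lorentzC lorentzBr !lorentzZr lorentz_AA// lorentz_A1//.
have qs := q_sqr Du.1; have e2 := eps_sqr 1%N; have l2 := lam_sqr.
transitivity (- (q (u 0 0) ^+ 2) * e1 +
              lam * lam * e1 * derive1 r (u 0 0) ^+ 2).
  by ring.
rewrite qs l2; transitivity (lam * (e1 * e1)); first by ring.
by rewrite e2 mulr1.
Qed.

Lemma pderivable2_n : pderivable2 D n.
Proof.
have oD := open_param_domain.
have c0 (f : R -> R) : derivable2 I f -> pderivable2 D (fun u => f (u 0 0)).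
  by move=> df; apply: (pderivable2_coord oD _ df) => u [].
have cF (i : nat) l : (1 <= i <= 4)%N ->
    pderivable2 D (fun u => F i (u 0 0) 0 l).
  move=> hi; apply: (c0 (fun s => F i s 0 l)); apply: (derivable2_entry _ oI).
  exact: smooth_derivable2 0%N (frame_smooth hF hi).
have dr : derivable2 I (derive1 r) by exact: smooth_derivable2 1%N hr.
have cq : pderivable2 D (fun u => q (u 0 0)).
  apply/c0/(derivable2_sqrt oI); first exact: derivable2_sqrB.
  by move=> s Is; rewrite subr_gt0 hr'.
have ccst : pderivable2 D (fun u : 'rV[R]_3 => - (lam * e1)).
  apply: (c0 (fun s => - (lam * e1))) => s _; split; first exact: derivable_cst.
  have -> : derive1 (fun _ : R => - (lam * e1)) = cst 0.
    by apply/funext => x; rewrite derive1_cst.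
  exact: derivable_cst.
apply: (pderivable2_mx oD) => l.
have caF (i : nat) : (2 <= i < 5)%N ->
    pderivable2 D ((fun u => acoef j i (u 0 1) (u 0 2)) *
                   (fun u => F i (u 0 0) 0 l)).
  move=> /andP[i2 i5]; apply: (pderivable2M oD).
    by apply: pderivable2_acoef; rewrite ?i2.
  by apply: cF; rewrite (ltnW i2).
have cn := pderivable2D oD (pderivable2M oD cq (pderivable2D oD (pderivable2D oD
  (caF 2%N isT) (caF 3%N isT)) (caF 4%N isT)))
  (pderivable2M oD (pderivable2M oD ccst (c0 _ dr)) (cF 1%N l isT)).
apply: (pderivable2_eq oD _ cn) => u Du.
rewrite /canal_normal /section_vector sum_normal_indices !mxE /=.
by rewrite /GRing.mul /GRing.add /= -!mulNr.
Qed.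

(** What is left of the derivative of [beta + r n] along the curve when [n] is
    kept constant.  It spans, in the tangent space, the orthogonal of the
    derivatives in the two other parameters. *)
Definition meridian u : 'rV[R]_4 :=
  F 1%N (u 0 0) + derive1 r (u 0 0) *: n u.

Local Notation T := meridian.
Local Notation Dn := (partial n).

Lemma derivable_n u i : D u -> derivable n u (delta_mx 0 i).
Proof. by move=> Du; exact: (pderivable2_n i Du).1. Qed.

Lemma derivable_F1 s : I s -> derivable (F 1%N) s 1.
Proof. exact: (frame_smooth hF (i := 1%N) isT (n := 0%N)). Qed.

Lemma is_derive_radial (f : R -> R) (V : 'rV[R]_3 -> 'rV[R]_4) u i :
  derivable f (u 0 0) 1 -> derivable V u (delta_mx 0 i) ->
  is_derive u (delta_mx 0 i) (fun v => f (v 0 0) *: V v)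
    ((derive1 f (u 0 0) *: V u) *+ (i == 0) +
     f (u 0 0) *: 'D_(delta_mx 0 i) V u).
Proof.
move=> df dV; apply: (is_derive_eq (is_derive_scale (is_derive_coord i df) dV)).
by rewrite (eq_sym 0); case: (i == 0); rewrite ?mulr1n// !mulr0n scale0r.
Qed.

Lemma is_derive_canal u i : D u ->
  is_derive u (delta_mx 0 i) (canal j lam beta F r)
    (T u *+ (i == 0) + r (u 0 0) *: Dn i u).
Proof.
move=> Du; have -> : canal j lam beta F r =
    (fun u => beta (u 0 0)) + (fun u => r (u 0 0) *: n u).
  by apply/funext => v; rewrite canalE.
have db : derivable beta (u 0 0) 1 by exact: (curve_smooth hF (n := 0%N) Du.1).
have dr : derivable r (u 0 0) 1 by exact: (hr (n := 0%N) Du.1).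
have dn := @derivable_n u i Du.
apply: (is_derive_eq
  (is_deriveD (is_derive_coord i db) (is_derive_radial dr dn))).
rewrite -(frame_tangent hF Du.1) (eq_sym 0) addrA; congr (_ + _).
by rewrite -mulrnDl.
Qed.

Lemma canal_partialE u i : D u -> X i u = T u *+ (i == 0) + r (u 0 0) *: Dn i u.
Proof. by move=> Du; rewrite /partial; have [_ ->] := is_derive_canal i Du. Qed.

Lemma derivable_canal_partial u i k : D u -> derivable (X i) u (delta_mx 0 k).
Proof.
move=> Du; have dF := derivable_F1 Du.1.
have dr : derivable r (u 0 0) 1 by exact: (hr (n := 0%N) Du.1).
have ddr : derivable (derive1 r) (u 0 0) 1 by exact: (hr (n := 1%N) Du.1).
have dDn : derivable (Dn i) u (delta_mx 0 k) by exact: (pderivable2_n i Du).2 k.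
have dT := derivableD (ex_derive (is_derive := is_derive_coord k dF))
  (ex_derive (is_derive := is_derive_radial ddr (@derivable_n u k Du))).
have dTi : derivable (fun v => T v *+ (i == 0)) u (delta_mx 0 k).
  by case: (i == 0); [exact: dT|exact: derivable_cst].
apply: near_eq_derivable
  (derivableD dTi (ex_derive (is_derive := is_derive_radial dr dDn))).
by apply: (open_near_eq open_param_domain) Du => v Dv; rewrite canal_partialE.
Qed.

Lemma lorentz_Tn u : D u -> lorentz (T u) (n u) = 0.
Proof.
move=> Du; rewrite lorentzDl lorentzZl lorentz_nn// lorentzC lorentz_nF1//.
by rewrite mulrC addNr.
Qed.

Lemma lorentz_TT u : D u ->
  lorentz (T u) (T u) = e1 - lam * derive1 r (u 0 0) ^+ 2.
Proof.
move=> Du; rewrite {2}/meridian lorentzDr lorentzZr lorentz_Tn// mulr0 addr0.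
rewrite lorentzDl lorentzZl lorentz_nF1// (frame_norm hF _ Du.1)//.
ring.
Qed.

Lemma lorentz_TT_neq0 u : D u -> lorentz (T u) (T u) != 0.
Proof.
move=> Du; rewrite lorentz_TT//.
have -> : e1 - lam * derive1 r (u 0 0) ^+ 2 =
    - lam * (derive1 r (u 0 0) ^+ 2 - lam * e1).
  transitivity (lam * lam * e1 - lam * derive1 r (u 0 0) ^+ 2); last by ring.
  by rewrite lam_sqr mul1r.
rewrite mulf_neq0 ?oppr_eq0 ?lam_neq0//.
by rewrite subr_eq0 gt_eqF// hr'//; exact: Du.1.
Qed.

(** The derivatives of [n] are never computed: what is needed of them comes
    from differentiating identities such as [lorentz (n u) (n u) = lam]. *)
Lemma derive_eq_on (f g : 'rV[R]_3 -> R) u v a b : D u ->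
  (forall x, D x -> f x = g x) ->
  is_derive u v f a -> is_derive u v g b -> a = b.
Proof.
move=> Du fg [_ <-] [_ <-]; apply: near_eq_derive.
exact: (open_near_eq open_param_domain).
Qed.

Lemma lorentz_Dnn u i : D u -> lorentz (Dn i u) (n u) = 0.
Proof.
move=> Du; have dn := @derivable_n u i Du.
have := derive_eq_on Du lorentz_nn (is_derive_lorentz dn dn)
  (is_derive_cst lam u (delta_mx 0 i)).
by rewrite [X in _ + X]lorentzC -mulr2n => /eqP; rewrite mulrn_eq0 => /eqP.
Qed.

(** This is where the curvature [k1] enters, through [F_1' = k1 F_2]. *)
Lemma lorentz_DnF1 u i : D u -> lorentz (Dn i u) (F 1%N (u 0 0)) =
  - (lam * derive1 (derive1 r) (u 0 0) +
     k1 (u 0 0) * (q (u 0 0) * (eps j 2 * acoef j 2 (u 0 1) (u 0 2))))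
  *+ (i == 0).
Proof.
move=> Du; have dn := @derivable_n u i Du.
have dF := derivable_F1 Du.1.
have ddr : derivable (derive1 r) (u 0 0) 1 by exact: (hr (n := 1%N) Du.1).
have [dFi DFi] := is_derive_coord i dF.
have := derive_eq_on Du lorentz_nF1 (is_derive_lorentz dn dFi)
  (is_deriveN (is_deriveZ lam (is_derive_coord i ddr))).
rewrite DFi (frenet1 hF Du.1) (eq_sym 0) -/(Dn i u) => /(canRL (addrK _)) ->.
case: (i == 0); rewrite ?mulr1n ?mulr0n.
  by rewrite lorentzZr lorentz_nF2// /GRing.scale /= opprD.
rewrite -(scale0r (0 : 'rV[R]_4)) lorentzZr /GRing.scale /=.
by rewrite mul0r mulr0 subr0 oppr0.
Qed.

Definition meridian_coef u : R :=
  lorentz (T u) (T u) - r (u 0 0) * (lam * derive1 (derive1 r) (u 0 0) +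
    k1 (u 0 0) * (q (u 0 0) * (eps j 2 * acoef j 2 (u 0 1) (u 0 2)))).

Local Notation m := meridian_coef.

Lemma lorentz_Xn u i : D u -> lorentz (X i u) (n u) = 0.
Proof.
move=> Du; rewrite canal_partialE// lorentzDl lorentzZl lorentz_Dnn//.
rewrite mulr0 addr0.
case: (i == 0); first exact: lorentz_Tn.
by rewrite mulr0n -(scale0r (n u)) lorentzZl mul0r.
Qed.

Lemma lorentz_XT u i : D u -> lorentz (X i u) (T u) = m u *+ (i == 0).
Proof.
move=> Du; rewrite canal_partialE// lorentzDl lorentzZl {3}/meridian lorentzDr.
rewrite lorentzZr lorentz_Dnn// lorentz_DnF1// mulr0 addr0.
case: (i == 0); first by rewrite !mulr1n mulrN.
by rewrite !mulr0n mulr0 addr0 -(scale0r (T u)) lorentzZl mul0r.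
Qed.

(** Differentiating [lorentz (X i) n = 0] turns the second derivatives of the
    hypersurface into [lorentz (X i) (Dn k)], and [r Dn k] is [X k] up to a
    multiple of the meridian. *)
Lemma canal_second_form u : D u ->
  r (u 0 0) *: (\matrix_(i, k) lorentz (partial (X i) k u) (n u)) + gram (X^~ u)
  = m u *: delta_mx 0 0.
Proof.
move=> Du; apply/matrixP => i k; rewrite !mxE.
have dXi := @derivable_canal_partial u i k Du.
have dn := @derivable_n u k Du.
have := derive_eq_on Du (fun u Du => lorentz_Xn i Du) (is_derive_lorentz dXi dn)
  (is_derive_cst 0 u (delta_mx 0 k)).
rewrite -/(partial (X i) k u) -/(Dn k u) => /eqP; rewrite addr_eq0 => /eqP ->.
rewrite (@canal_partialE u k Du) lorentzDr lorentzZr mulrN addrCA addNr addr0.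
case: (k == 0); last first.
  by rewrite mulr0n -(scale0r (T u)) lorentzZr mul0r andbF mulr0.
by rewrite mulr1n lorentz_XT// andbT mulr_natr.
Qed.

(** A unit normal field need not be continuous, so it equals [n] only up to a
    factor that may change from point to point. *)
Lemma unit_normal_colinear u y : D u -> \det (gram (X^~ u)) != 0 ->
  (forall i, lorentz (X i u) y = 0) -> y = (lam * lorentz (n u) y) *: n u.
Proof.
move=> Du dG Xy; apply/eqP; rewrite -subr_eq0; apply/eqP.
have n0 : lorentz (n u) (n u) != 0 by rewrite lorentz_nn// lam_neq0.
apply: (lorentz_frame_eq0 dG n0) => [i|i|].
- exact: lorentz_Xn.
- by rewrite lorentzBr lorentzZr Xy lorentz_Xn// mulr0 subr0.
- by rewrite lorentzBr lorentzZr lorentz_nn// mulrAC lam_sqr mul1r subrr.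
Qed.

(** By [trace_inv_gram] the mean curvature vanishes exactly when
    [lorentz T T = 3 m]; the equation below is this one multiplied by [lam]. *)
Lemma canal_mean_curvature_eq0 (N : 'rV[R]_3 -> 'rV[R]_4) u : D u ->
  \det (gram (X^~ u)) != 0 -> `|lorentz (N u) (N u)| = 1 ->
  (forall i, lorentz (X i u) (N u) = 0) ->
  mean_curvature (canal j lam beta F r) N u = 0 <->
  3 * r (u 0 0) * derive1 (derive1 r) (u 0 0) +
  2 * (derive1 r (u 0 0) ^+ 2 - lam * e1) +
  3 * lam * eps j 2 * r (u 0 0) * k1 (u 0 0) * q (u 0 0) *
    acoef j 2 (u 0 1) (u 0 2) = 0.
Proof.
move=> Du dG N1 XN.
have n0 : lorentz (n u) (n u) != 0 by rewrite lorentz_nn// lam_neq0.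
have N0 : lorentz (N u) (N u) != 0 by rewrite -normr_eq0 N1 oner_eq0.
have [c NE] : exists c, N u = c *: n u.
  by eexists; exact: unit_normal_colinear Du dG XN.
have c0 : c != 0 by apply: contra_neq N0 => c0; rewrite NE c0 lorentzZl mul0r.
pose h := \matrix_(i, k) lorentz (partial (X i) k u) (n u).
have hE : second_form (canal j lam beta F r) N u = c *: h.
  by apply/matrixP => i k; rewrite !mxE NE lorentzZr.
have key := trace_inv_gram dG n0 (fun i => lorentz_Xn i Du) (lorentz_Tn Du)
  (fun i => lorentz_XT i Du) (canal_second_form Du).
rewrite -/h in key.
have TT0 := lorentz_TT_neq0 Du.
have r0 : r (u 0 0) != 0 by rewrite gt_eqF// hr_gt0//; exact: Du.1.
have trE : \tr (shape_operator (canal j lam beta F r) N u) =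
    c * \tr (invmx (gram (X^~ u)) *m h).
  by rewrite /shape_operator hE -scalemxAr mxtraceZ.
have -> : mean_curvature (canal j lam beta F r) N u = 0 <->
    \tr (invmx (gram (X^~ u)) *m h) = 0.
  rewrite /mean_curvature trE; split=> [/eqP|->]; last by rewrite mulr0 mul0r.
  rewrite !mulf_eq0 (negPf c0) invr_eq0 mulf_eq0 (negPf N0) pnatr_eq0 /= !orbF.
  by move/eqP.
have -> : \tr (invmx (gram (X^~ u)) *m h) = 0 <->
    lorentz (T u) (T u) - 3 * m u = 0.
  rewrite key; split=> [->|/eqP]; first by rewrite mulr0.
  rewrite !mulf_eq0 (negPf r0) /= => /orP[/eqP m0|/eqP//].
  by move: key TT0; rewrite m0 !mulr0 mul0r subr0 => ->; rewrite eqxx.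
rewrite /meridian_coef lorentz_TT//.
have l2 := lam_sqr.
set x := (X in X = 0 <-> _); set y := (X in _ <-> X = 0).
have -> : y = lam * x.
  by rewrite /x /y; ring: l2.
split=> [->|/eqP]; first by rewrite mulr0.
by rewrite mulf_eq0 (negPf lam_neq0) => /eqP.
Qed.

End CanalGeometry.

(** * The equations of minimality *)

Section NonConstancy.
Context {R : realType}.
Implicit Types (W : set (R * R)) (f g : R -> R) (c : R).

Lemma derive_const_prodl W f f' g c : open W ->
  (forall x : R, is_derive x 1 f (f' x)) ->
  (forall t w, W (t, w) -> f t * g w = c) ->
  forall t w, W (t, w) -> f' t * g w = 0.
Proof.
move=> oW df fgc t w Wtw.
have oP : open ((fun x => (x, w)) @^-1` W).
  have cx : continuous (fun x : R => (x, w)).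
    by move=> x; exact: (cvg_pair (@cvg_id _ _) (cvg_cst _)).
  exact: (open_comp (fun x _ => cx x) oW).
have dfg : is_derive t 1 (g w *: f) (g w *: f' t) by exact: is_deriveZ.
have [_ d0] : is_derive t 1 (cst c) (g w *: f' t).
  apply: near_eq_is_derive dfg; apply: (open_near_eq oP) Wtw => x Wx.
  by rewrite -(fgc _ _ Wx) mulrC.
by rewrite mulrC -[LHS]d0 derive_cst.
Qed.

Lemma derive_const_prodr W f g g' c : open W ->
  (forall x : R, is_derive x 1 g (g' x)) ->
  (forall t w, W (t, w) -> f t * g w = c) ->
  forall t w, W (t, w) -> f t * g' w = 0.
Proof.
move=> oW dg fgc t w Wtw.
have oP : open ((fun x => (t, x)) @^-1` W).
  have cx : continuous (fun x : R => (t, x)).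
    by move=> x; exact: (cvg_pair (cvg_cst _) (@cvg_id _ _)).
  exact: (open_comp (fun x _ => cx x) oW).
have dfg : is_derive w 1 (f t *: g) (f t *: g' w) by exact: is_deriveZ.
have [_ d0] : is_derive w 1 (cst c) (f t *: g' w).
  apply: near_eq_is_derive dfg; apply: (open_near_eq oP) Wtw => x Wx.
  by rewrite -(fgc _ _ Wx).
by rewrite -[LHS]d0 derive_cst.
Qed.

(** Only [acoef j 2] multiplies the curvature in the minimality equation, so its
    variation over [W] forces the curvature to vanish.  Differentiating a
    constant value of [acoef j 2] leads to [cosh x = 0], or, for [j = 1], to
    [cos t = sin t = 0]. *)
Lemma acoef2_not_constant (j : nat) W c : (1 <= j <= 4)%N -> open W ->
  W !=set0 -> ~ (forall t w, W (t, w) -> acoef j 2 t w = c).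
Proof.
move=> hj oW [[t w] Wtw] a2c.
have ch0 x : cosh x != 0 :> R.
  by rewrite gt_eqF// divr_gt0// addr_gt0// expR_gt0.
have d1 := @derive_const_prodl W; have d2 := @derive_const_prodr W.
have dcos : forall x : R, is_derive x 1 cos (- sin x).
  exact: is_derive_cos.
have dsin : forall x : R, is_derive x 1 sin (cos x).
  exact: is_derive_sin.
case: j hj a2c => [|[|[|[|[|j]]]]]//= _ a2c.
- have s0 t1 w1 : W (t1, w1) -> sin t1 * 1 = 0.
    move=> W1; have sc := d1 _ _ _ _ oW dcos a2c.
    have := sc _ _ W1; have := d2 _ _ _ _ oW dcos sc _ _ W1.
    rewrite mulr1 !mulNr mulrN opprK => /eqP + /eqP.
    rewrite oppr_eq0 !mulf_eq0 => /orP[/eqP//|/eqP sw] /orP[/eqP//|/eqP cw].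
    have := cos2Dsin2 w1; rewrite sw cw expr0n addr0 => /eqP.
    by rewrite eq_sym oner_eq0.
  have c0 := d1 _ _ (fun=> 1) _ oW dsin s0 _ _ Wtw.
  have := cos2Dsin2 t; rewrite -(mulr1 (cos t)) -(mulr1 (sin t)).
  by rewrite c0 (s0 _ _ Wtw) expr0n addr0 => /eqP; rewrite eq_sym oner_eq0.
- have sc := d1 _ _ _ _ oW is_derive_cosh a2c.
  have /eqP := d1 _ _ _ _ oW is_derive_sinh sc _ _ Wtw.
  by rewrite mulf_eq0 !(negPf (ch0 _)).
- have /eqP := d1 _ _ _ _ oW is_derive_sinh a2c _ _ Wtw.
  by rewrite mulf_eq0 !(negPf (ch0 _)).
- have a2c' t1 w1 : W (t1, w1) -> 1 * sinh w1 = c.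
    by rewrite mul1r; exact: a2c.
  have /eqP := d2 (fun=> 1) _ _ _ oW is_derive_sinh a2c' _ _ Wtw.
  by rewrite mul1r (negPf (ch0 _)).
Qed.

End NonConstancy.

Definition radius_ode (R : realType) (mu : R) (r : R -> R) (s : R) : R :=
  3 * r s * derive1 (derive1 r) s + 2 * (derive1 r s ^+ 2 - mu).

Lemma minimal_canalP (R : realType) (j : nat) (lam : R)
    (I : set R) (W : set (R * R))
    (beta : R -> 'rV[R]_4) (F : nat -> R -> 'rV[R]_4)
    (k1 k2 k3 r : R -> R) (N : 'rV[R]_3 -> 'rV[R]_4) :
  (1 <= j <= 4)%N -> lam = 1 \/ lam = -1 ->
  open I -> open W -> W !=set0 ->
  frenet_curve j I beta F k1 k2 k3 ->
  smooth_on I r -> (forall s, I s -> 0 < r s) ->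
  (forall s, I s -> lam * eps j 1 < (derive1 r s) ^+ 2) ->
  regular_on (canal j lam beta F r) (param_domain I W) ->
  unit_normal_on (canal j lam beta F r) N (param_domain I W) ->
  minimal_on (canal j lam beta F r) N (param_domain I W) <->
  forall s, I s -> k1 s = 0 /\ radius_ode (lam * eps j 1) r s = 0.
Proof.
move=> hj hlam oI oW W0 hF hr hr_gt0 hr' hreg hN.
have H u Du := canal_mean_curvature_eq0 hj hlam oI oW hF hr hr_gt0 hr' Du
  (hreg u Du) (hN u Du).1 (hN u Du).2.
split=> [min s Is|ode u Du]; last first.
  apply/H => //; have [k0 e0] := ode _ Du.1.
  by rewrite k0 mulr0 !mul0r addr0.
pose pt t w : 'rV[R]_3 := \row_i [:: s; t; w]`_i.
pose b := 3 * lam * eps j 2 * r s * k1 s *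
  Num.sqrt (derive1 r s ^+ 2 - lam * eps j 1).
have mint t w : W (t, w) ->
    radius_ode (lam * eps j 1) r s + b * acoef j 2 t w = 0.
  move=> Wtw; have Du : param_domain I W (pt t w) by split; rewrite !mxE.
  by have := (H _ Du).1 (min _ Du); rewrite !mxE.
have b0 : b = 0.
  apply/eqP/negP => /negP b0.
  pose c := - radius_ode (lam * eps j 1) r s / b.
  apply: (acoef2_not_constant (c := c) hj oW W0) => t w Wtw.
   apply: (mulfI b0); rewrite [RHS]mulrC divfK//.
  by apply/eqP; rewrite -addr_eq0 addrC mint.
have k0 : k1 s = 0.
  apply/eqP; move/eqP: b0; rewrite /b !mulf_eq0 pnatr_eq0 /=.
  rewrite (negPf (lam_neq0 hlam)).
  have -> : (@eps R j 2 == 0) = false.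
    by apply/negbTE; rewrite /eps; case: ifP => _; rewrite ?oppr_eq0 oner_eq0.
  have -> : (Num.sqrt (derive1 r s ^+ 2 - lam * eps j 1) == 0) = false.
    by apply/negbTE; rewrite gt_eqF// sqrtr_gt0 subr_gt0 hr'.
  by rewrite (gt_eqF (hr_gt0 _ Is)) orbF.
split=> //; have [[t w] Wtw] := W0.
by have := mint _ _ Wtw; rewrite b0 mul0r addr0.
Qed.

(** * Antiderivatives of the integrand *)

Section Antiderivative.
Context {R : realType}.
Variables (mu c : R).
Hypothesis c_gt0 : 0 < c.
Implicit Types x y u : R.

Lemma radicand_cube (e c1 x : R) : 0 < x ->
  (radicand e c1 x - e) ^+ 3 * x ^+ 4 = c1 ^+ 4.
Proof.
move=> x0; rewrite /radicand addrC addKr -powR_mulrn ?powR_ge0// -powRrM.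
rewrite (_ : 4 / 3 * 3%:R = 4%:R); last by rewrite divfK// pnatr_eq0.
rewrite powR_mulrn// normrM exprMn (gtr0_norm (_ : 0 < x^-1)) ?invr_gt0//.
rewrite -normrX ger0_norm ?exprn_even_ge0// -mulrA -exprMn.
by rewrite mulVf ?gt_eqF// expr1n mulr1.
Qed.

Lemma radicand_le x y : 0 < x -> x <= y -> radicand mu c y <= radicand mu c x.
Proof.
move=> x0 xy; have y0 := lt_le_trans x0 xy.
rewrite lerD2l; apply: ge0_ler_powR; rewrite ?nnegrE ?divr_ge0//.
by rewrite !gtr0_norm ?divr_gt0// ler_pM2l// lef_pV2.
Qed.

Lemma continuous_radicand x : 0 < x -> {for x, continuous (radicand mu c)}.
Proof.
move=> x0; apply: cvgD; first exact: cvg_cst.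
have q0 : 0 < `|c / x| by rewrite normr_gt0 mulf_neq0// ?invr_eq0 gt_eqF.
have powc : {for `|c / x|, continuous (fun a : R => a `^ (4 / 3))}.
  apply/differentiable_continuous/derivable1_diffP.
  by have [] := is_derive1_powR (4 / 3) q0.
apply: (@continuous_comp _ _ _ (fun y => `|c / y|)
  (fun a : R => a `^ (4 / 3))) => //.
apply: cvg_norm; apply: cvgM; first exact: cvg_cst.
by apply: cvgV => //; rewrite gt_eqF.
Qed.

Lemma continuous_integrand x :
  integrand_dom mu c x -> {for x, continuous (integrand mu c)}.
Proof.
move=> [x0 rx]; apply: cvgM; first exact: cvg_cst.
apply: cvgV; first by rewrite gt_eqF// sqrtr_gt0.
apply: (@continuous_comp _ _ _ (radicand mu c) Num.sqrt).
  exact: continuous_radicand.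
exact: sqrt_continuous.
Qed.

Lemma integrand_dom_right x : integrand_dom mu c x ->
  exists2 u, x < u & integrand_dom mu c u.
Proof.
move=> [x0 rx]; have rgt : \forall y \near x, 0 < radicand mu c y.
  exact: (cvgr_gt _ (continuous_radicand x0)).
have [d /= d0 xd] := (nbhs_ballP _ _).1 rgt.
exists (x + d / 2); first by rewrite ltrDl divr_gt0.
split; first by rewrite addr_gt0// divr_gt0.
apply: xd; rewrite /ball /= opprD addNKr normrN gtr0_norm ?divr_gt0//.
by rewrite ltr_pdivrMr// mulr2n mulrDr mulr1 ltrDl.
Qed.

Lemma integrand_dom_le x y :
  0 < x -> x <= y -> integrand_dom mu c y -> integrand_dom mu c x.
Proof.
by move=> x0 xy [_ ry]; split=> //; exact: lt_le_trans ry (radicand_le _ _).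
Qed.

Lemma integrand_le x y : 0 < x -> x <= y -> integrand_dom mu c y ->
  0 <= integrand mu c x <= integrand mu c y.
Proof.
move=> x0 xy dy; have [_ rx] := integrand_dom_le x0 xy dy; have [_ ry] := dy.
rewrite divr_ge0 ?sqrtr_ge0//= ler_pM2l// lef_pV2 ?posrE ?sqrtr_gt0//.
by rewrite ler_sqrt ?radicand_le// ltW.
Qed.

Lemma integrable_integrand u : integrand_dom mu c u ->
  (@lebesgue_measure R).-integrable [set` `]0, u]%R] (EFin \o integrand mu c).
Proof.
move=> du; have [u0 _] := du.
have fin : (lebesgue_measure [set` `]0%R, u]%R] < +oo)%E.
  by rewrite lebesgue_measure_itv /= lte_fin u0 ltry.
apply: measurable_bounded_integrable => //.
- apply: subspace_continuous_measurable_fun => //.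
  apply: continuous_in_subspaceT => x; rewrite inE /= in_itv /= => /andP[x0 xu].
  exact: continuous_integrand (integrand_dom_le x0 xu du).
- exists (integrand mu c u); split; rewrite ?num_real// => M uM x /=.
  rewrite in_itv /= => /andP[x0 xu]; have /andP[f0 fu] := integrand_le x0 xu du.
  rewrite (ger0_norm f0); exact: le_trans fu (ltW uM).
Qed.

(** The domain is an interval with left end 0 and the integrand, increasing,
    is bounded near 0; hence one integral from 0 serves on the whole domain. *)
Lemma antiderivative_exists : exists Phi : R -> R, is_antiderivative mu c Phi.
Proof.
exists (fun x =>
  \int[@lebesgue_measure R]_(t in [set` `]0, x]%R]) integrand mu c t)%R.
move=> x dx; have [x0 _] := dx; have [u xu du] := integrand_dom_right dx.
have x0' : (BRight (0 : R) < BRight x)%O by rewrite bnd_simp.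
have [dPhi PhiE] := continuous_FTC1 xu (integrable_integrand du) x0'
  (continuous_integrand dx).
by split; [exact: dPhi|rewrite -derive1E; exact: PhiE].
Qed.

End Antiderivative.

(** * The differential equation of the radius *)

Section RadiusEquation.
Context {R : realType}.
Implicit Types (I J : set R) (f g r : R -> R) (s x y : R).

Lemma derivable1_is_derive f s :
  derivable f s 1 -> is_derive s 1 f (derive1 f s).
Proof. by move=> df; rewrite derive1E; exact: derivableP df. Qed.

Lemma near_itv (P : set R) s : (\forall x \near s, P x) ->
  exists2 d, 0 < d & forall x, x \in `]s - d, s + d[%R -> P x.
Proof.
move=> /nbhs_ballP[d /= d0 dP]; exists d => // x.
by rewrite in_itv /= => xsd; apply: dP; rewrite /ball /= distrC ltr_distl.
Qed.

Lemma derive0_const J f : is_interval J ->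
  (forall x, J x -> is_derive x 1 f 0) -> forall x y, J x -> J y -> f x = f y.
Proof.
move=> iJ df; suff H x y : J x -> J y -> x <= y -> f x = f y.
  by move=> x y Jx Jy; have [/H->//|/ltW /H->] := leP x y.
move=> Jx Jy xy.
have Jz z : z \in `[x, y]%R -> J z.
  by rewrite in_itv /=; exact: iJ Jx Jy z.
have cf : {within `[x, y], continuous f}.
  by apply: derivable_within_continuous => z /Jz /df [].
have df' z : z \in `]x, y[%R -> is_derive z 1 f 0.
  by move=> /(@subset_itv_oo_cc _ _ _ _ z) /Jz /df.
have [z _] := MVT_segment xy df' cf.
by rewrite mul0r => /eqP; rewrite subr_eq0 => /eqP.
Qed.

Lemma nondecreasing_derive1_ge0 J f s : open J -> J s ->
  (forall x y, J x -> J y -> x <= y -> f x <= f y) ->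
  derivable f s 1 -> 0 <= derive1 f s.
Proof.
move=> oJ Js fJ df; rewrite derive1E.
apply: limr_ge; first exact: df.
have nearJ : \forall h \near (0 : R)^', J (h + s).
  apply: cvg_within.
  have cs : {for 0, continuous (fun h : R => h + s)}.
    by apply: cvgD; [exact: cvg_id|exact: cvg_cst].
  apply: cs; rewrite add0r; exact: open_nbhs_nbhs (conj oJ Js).
near=> h; have Jh : J (h + s) by near: h.
have h0 : h != 0 by near: h; exact: nbhs_dnbhs_neq.
rewrite /= [h%:A]mulr1 /GRing.scale /=.
have [hp|hn] := leP 0 h.
  by rewrite mulr_ge0 ?invr_ge0// subr_ge0 fJ// lerDr.
rewrite mulr_le0 ?invr_le0 ?(ltW hn)// subr_le0 fJ//.
by rewrite gerDr ltW.
Unshelve. all: by end_near. Qed.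

Lemma interior_min_derive1 J f s : open J -> J s ->
  (forall x, J x -> derivable f x 1) -> (forall x, J x -> f s <= f x) ->
  derive1 f s = 0.
Proof.
move=> oJ Js df fmin; have [d d0 dJ] := near_itv (open_nbhs_nbhs (conj oJ Js)).
rewrite derive1E.
have sd : s \in `]s - d, s + d[%R.
  by rewrite in_itv /= ltrBlDr ltrDl d0.
have ab : s - d <= s + d by rewrite lerBlDr -addrA lerDl addr_ge0// ltW.
by have [_ ->] := derive1_at_min ab (fun x xd => df x (dJ x xd)) sd
  (fun x xd => fmin x (dJ x xd)).
Qed.

(** The cube of [(r'^2 - mu) r^(4/3)], taken to stay with integer powers. *)
Definition first_integral (mu : R) r s : R :=
  (derive1 r s ^+ 2 - mu) ^+ 3 * r s ^+ 4.

Lemma is_derive_first_integral mu r s :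
  derivable r s 1 -> derivable (derive1 r) s 1 ->
  is_derive s 1 (first_integral mu r)
    (2 * r s ^+ 3 * (derive1 r s ^+ 2 - mu) ^+ 2 * derive1 r s *
     radius_ode mu r s).
Proof.
move=> /derivable1_is_derive Dr /derivable1_is_derive DDr.
have D1 := is_deriveB (is_deriveX 2 DDr) (is_derive_cst mu s 1).
have D2 := is_deriveM (is_deriveX 3 D1) (is_deriveX 4 Dr).
have -> : first_integral mu r = ((derive1 r ^+ 2 - cst mu) ^+ 3 * r ^+ 4)%R.
  by apply/funext => x; rewrite /first_integral !fctE.
apply: (is_derive_eq D2).
rewrite !fctE /radius_ode /GRing.scale /= subr0.
ring.
Qed.

(** The first integral gives [r'^2 = mu + (c / r)^(4/3)], where [c^4] is its
    value.  On a branch [r'] cannot vanish: being of constant sign it would have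
    an extremum there, so that [r'' = 0], and the equation would read [mu = 0]
    whereas [mu < r'^2 = 0].  Hence [r'] is plus or minus the square root, and
    the antiderivative composed with [r] has derivative 1 or -1. *)
Lemma radius_ode_integral_relation mu I r : open_interval I -> smooth_on I r ->
  (forall s, I s -> 0 < r s) -> (forall s, I s -> mu < derive1 r s ^+ 2) ->
  (forall s, I s -> radius_ode mu r s = 0) -> integral_relation mu I r.
Proof.
move=> [[s0 Is0] oI iI] hr r0 hmu ode.
have dr s : I s -> derivable r s 1 by move=> Is; exact: (hr 0%N s Is).
have ddr s : I s -> derivable (derive1 r) s 1.
  by move=> Is; exact: (hr 1%N s Is).
have K0 : 0 < first_integral mu r s0.
  by rewrite mulr_gt0 ?exprn_gt0 ?subr_gt0 ?hmu ?r0.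
pose c := Num.sqrt (Num.sqrt (first_integral mu r s0)).
have c0 : 0 < c by rewrite !sqrtr_gt0.
have cK : c ^+ 4 = first_integral mu r s0.
  by rewrite -[4%N]/(2 * 2)%N exprM !sqr_sqrtr// ?sqrtr_ge0// ltW.
have radE s : I s -> radicand mu c (r s) = derive1 r s ^+ 2.
  move=> Is; apply: (addIr (- mu)).
  have p0 : 0 <= radicand mu c (r s) - mu.
    by rewrite /radicand addrC addKr powR_ge0.
  apply: (@pexpIrn _ 3) => //; rewrite ?nnegrE ?subr_ge0 ?(ltW (hmu _ Is))//.
  apply: (mulIf (_ : r s ^+ 4 != 0)); first by rewrite expf_neq0// gt_eqF// r0.
  rewrite radicand_cube ?r0// cK -/(first_integral mu r s).
  apply: (derive0_const iI _ Is0 Is) => x Ix.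
  have := is_derive_first_integral mu (dr x Ix) (ddr x Ix).
  by rewrite ode// mulr0.
have [Phi dPhi] := antiderivative_exists mu c0.
exists c; exists Phi => // J [[s1 Js1] oJ iJ] JI rJ.
have [sg [sgE sgr]] : exists sg : R, (sg = 1 \/ sg = -1) /\
    forall s, J s -> 0 <= sg * derive1 r s.
  case: rJ => rJ.
    exists 1; split; [by left|move=> s Js; rewrite mul1r].
    exact: (nondecreasing_derive1_ge0 oJ Js rJ (dr s (JI s Js))).
  exists (-1); split; [by right|move=> s Js; rewrite mulN1r].
  have drs := dr s (JI s Js).
  rewrite derive1E -deriveN// -derive1E.
  apply: (nondecreasing_derive1_ge0 oJ Js) (derivableN drs) => x y Jx Jy xy.
  by rewrite lerN2 rJ.
have sg2 : sg * sg = 1 by case: sgE => ->; rewrite ?mulrNN mulr1.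
have sg_neq0 : sg != 0.
  by apply: contra_eq_neq sg2 => ->; rewrite mul0r eq_sym oner_neq0.
have r'_neq0 s : J s -> derive1 r s != 0.
  move=> Js; apply/eqP => r's0.
  have dmin : derive1 (sg *: derive1 r) s = 0.
    apply: (interior_min_derive1 oJ Js) => x Jx.
      exact: (derivableZ (ddr x (JI x Jx))).
    change (sg * derive1 r s <= sg * derive1 r x).
    by rewrite r's0 mulr0 sgr.
  have r''0 : derive1 (derive1 r) s = 0.
    apply: (mulfI sg_neq0); rewrite mulr0 -[RHS]dmin [RHS]derive1E deriveZ.
      by rewrite -derive1E.
    exact: (ddr s (JI s Js)).
  have := ode s (JI s Js); have := hmu s (JI s Js).
  rewrite /radius_ode r's0 r''0 expr0n /= mulr0 add0r sub0r => mu0 /eqP.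
  by rewrite mulf_eq0 pnatr_eq0 oppr_eq0 /= (lt_eqF mu0).
have domJ s : J s -> integrand_dom mu c (r s).
  move=> Js; split; first exact: (r0 s (JI s Js)).
  by rewrite (radE s (JI s Js)) exprn_even_gt0//= r'_neq0.
have intE s : J s -> integrand mu c (r s) * derive1 r s = sg.
  move=> Js; rewrite /integrand (radE s (JI s Js)) sqrtr_sqr.
  (* [sg * r'] is nonnegative and [sg] has norm 1 *)
  have -> : `|derive1 r s| = sg * derive1 r s.
    rewrite -[RHS]ger0_norm ?sgr// normrM.
    by case: sgE => ->; rewrite ?normrN normr1 mul1r.
  by have r'0 := r'_neq0 _ Js; field: sg2; rewrite r'0 sg_neq0.
have dF s : J s -> is_derive s 1 (fun x => Phi (r x) - sg * x) 0.
  move=> Js; have Dr := derivable1_is_derive (dr s (JI s Js)).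
  have DP := is_derive1_comp (dPhi _ (domJ s Js)) Dr.
  rewrite intE// in DP.
  have := is_deriveB DP (is_deriveZ sg (is_derive_id s 1)).
  by rewrite [sg *: 1]mulr1 subrr.
exists sg, (Phi (r s1) - sg * s1); split=> // s Js; split; first exact: domJ.
by rewrite -(derive0_const iJ dF Js Js1) addrC subrK.
Qed.

(** Where [r'] is nonzero, [r] is monotone nearby, and differentiating the
    relation of that branch shows that the first integral is constant.  At a
    zero of [r'] the equation holds by continuity unless [r'] vanishes nearby;
    but then [r] is constant on an interval, against the relation, whose right
    side is not. *)
Lemma integral_relation_radius_ode mu I r : open_interval I -> smooth_on I r ->
  (forall s, I s -> 0 < r s) -> (forall s, I s -> mu < derive1 r s ^+ 2) ->
  integral_relation mu I r -> forall s, I s -> radius_ode mu r s = 0.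
Proof.
move=> [_ oI iI] hr r0 hmu [c [Phi dPhi rel]].
have dr s : I s -> derivable r s 1 by move=> Is; exact: (hr 0%N s Is).
have ddr s : I s -> derivable (derive1 r) s 1.
  by move=> Is; exact: (hr 1%N s Is).
have dddr s : I s -> derivable (derive1 (derive1 r)) s 1.
  by move=> Is; exact: (hr 2%N s Is).
have cont f s : derivable f s 1 -> {for s, continuous f}.
  by move=> df; apply/differentiable_continuous/derivable1_diffP.
have branch s d : 0 < d -> open_interval [set` `]s - d, s + d[%R].
  move=> d0; split; [|exact: interval_open|exact: interval_is_interval].
  by exists s; rewrite /= in_itv /= ltrBlDr ltrDl d0.
have regular s : I s -> derive1 r s != 0 -> radius_ode mu r s = 0.
  move=> Is r's0.
  have [d d0 [dI mono]] : exists2 d, 0 < d &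
      [set` `]s - d, s + d[%R] `<=` I /\ monotone_on [set` `]s - d, s + d[%R] r.
    (* [sg] is the sign of [derive1 r s] in both uses *)
    have sgn (sg : R) : 0 < sg * derive1 r s -> exists2 d, 0 < d & forall x,
        x \in `]s - d, s + d[%R -> I x /\ 0 < sg * derive1 r x.
      move=> sgs.
      have near_s : \forall x \near s, I x /\ 0 < sg * derive1 r x.
        apply: filterI; first exact: open_nbhs_nbhs (conj oI Is).
        have cs : {for s, continuous (fun x => sg * derive1 r x)}.
          by apply: cvgM; [exact: cvg_cst|exact: cont (ddr s Is)].
        exact: (cvgr_gt _ cs).
      exact: near_itv near_s.
    have [r'gt0|r'le0] := ltP 0 (derive1 r s).
      have [|d d0 dP] := sgn 1; first by rewrite mul1r.
      exists d => //; split=> [x /dP[]//|]; left=> x y xJ yJ xy.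
      apply: (ger0_derive1_le_oo _ _ _ xJ yJ xy) => [z /dP[Iz _]|z /dP[_]|z].
      - exact: dr.
      - by rewrite mul1r => /ltW.
      - by rewrite inE => /dP[Iz _]; exact: cont (dr z Iz).
    have [|d d0 dP] := sgn (-1).
      by rewrite mulN1r oppr_gt0 lt_neqAle r's0.
    exists d => //; split=> [x /dP[]//|]; right=> x y xJ yJ xy.
    apply: (ler0_derive1_le_oo _ _ _ yJ xJ xy) => [z /dP[Iz _]|z /dP[_]|z].
    - exact: dr.
    - by rewrite mulN1r oppr_gt0 => /ltW.
    - by rewrite inE => /dP[Iz _]; exact: cont (dr z Iz).
  have [sg [c2 [sgE PhiE]]] := rel _ (branch s d d0) dI mono.
  have Js : [set` `]s - d, s + d[%R] s by rewrite /= in_itv /= ltrBlDr ltrDl d0.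
  have oJ : open [set` `]s - d, s + d[%R] by exact: interval_open.
  have sg2 : sg * sg = 1 by case: sgE => ->; rewrite ?mulrNN mulr1.
  have fiE x : [set` `]s - d, s + d[%R] x -> first_integral mu r x = c ^+ 4.
    move=> Jx; have Ix := dI _ Jx; have [[rx0 radx0] _] := PhiE _ Jx.
    have Dr := derivable1_is_derive (dr x Ix).
    have [_ E1] := is_derive1_comp (dPhi _ (PhiE _ Jx).1) Dr.
    have [_ E2] := is_deriveD (is_deriveZ sg (is_derive_id x 1))
      (is_derive_cst c2 x 1).
    have E : integrand mu c (r x) * derive1 r x = sg.
      rewrite -E1 -[RHS]mulr1 -[RHS]addr0 -[RHS]E2; apply: near_eq_derive.
      by apply: (open_near_eq oJ) Jx => y /PhiE[].
    rewrite -(radicand_cube mu c rx0) /first_integral; congr ((_ - _) ^+ _ * _).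
    have q0 : Num.sqrt (radicand mu c (r x)) != 0 by rewrite gt_eqF// sqrtr_gt0.
    have -> : derive1 r x = sg * Num.sqrt (radicand mu c (r x)).
      by rewrite -E /integrand mulrAC div1r mulVf// mul1r.
    by rewrite exprMn expr2 sg2 mul1r sqr_sqrtr// ltW.
  have [_ E1] := is_derive_first_integral mu (dr s Is) (ddr s Is).
  have /eqP : 'D_1 (first_integral mu r) s = 0.
    have -> : 'D_1 (first_integral mu r) s = 'D_1 (cst (c ^+ 4)) s.
      by apply: near_eq_derive; exact: (open_near_eq oJ).
    by rewrite derive_cst.
  have rs0 : (r s == 0) = false by rewrite gt_eqF// r0.
  have ps0 : (derive1 r s ^+ 2 - mu == 0) = false.
    by rewrite gt_eqF// subr_gt0 hmu.
  by rewrite E1 !mulf_eq0 pnatr_eq0 (negPf r's0) rs0 ps0 /= => /eqP.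
move=> s Is; apply/eqP; apply: contraT => ode0.
have codes : {for s, continuous (radius_ode mu r)}.
  have cr' := cont _ _ (ddr s Is).
  apply: cvgD.
    apply: cvgM; last exact: cont (dddr s Is).
    by apply: cvgM; [exact: cvg_cst|exact: cont (dr s Is)].
  apply: cvgM; first exact: cvg_cst.
  by apply: cvgB; [exact: (cvgM cr' cr')|exact: cvg_cst].
have near_s : \forall x \near s, I x /\ radius_ode mu r x != 0.
  apply: filterI; first exact: open_nbhs_nbhs (conj oI Is).
  exact: (cvgr_neq0 _ codes).
have [d d0 dP] := near_itv near_s.
have [_ oJ iJ] := branch s d d0.
(* where the equation fails, [r'] vanishes by the regular case *)
have rc x y : x \in `]s - d, s + d[%R -> y \in `]s - d, s + d[%R -> r x = r y.
  apply: (derive0_const iJ) => z /dP[Iz odez].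
  have [r'0|r'0] := eqVneq (derive1 r z) 0.
    by rewrite -r'0; exact: derivable1_is_derive (dr z Iz).
  by rewrite (regular z Iz r'0) eqxx in odez.
have [] := rel _ (branch s d d0).
- by move=> x /dP[].
- by left=> x y xJ yJ _; rewrite (rc x y).
move=> sg [c2 [sgE PhiE]].
have Js : s \in `]s - d, s + d[%R by rewrite in_itv /= ltrBlDr ltrDl d0.
have Js' : s + d / 2 \in `]s - d, s + d[%R.
  by rewrite in_itv /=; apply/andP; split; lra.
have := (PhiE _ Js').2; rewrite (rc _ _ Js' Js) (PhiE _ Js).2 => /addIr /eqP.
rewrite -subr_eq0 -mulrBr opprD addNKr mulf_eq0 oppr_eq0 mulf_eq0 invr_eq0.
rewrite pnatr_eq0 (gt_eqF d0) !orbF => /eqP sg0; case: sgE; rewrite sg0 => /eqP.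
  by rewrite eq_sym oner_eq0.
by rewrite eq_sym oppr_eq0 oner_eq0.
Qed.

End RadiusEquation.

Theorem theorem5 (R : realType) (j : nat) (lam : R)
    (I : set R) (W : set (R * R))
    (beta : R -> 'rV[R]_4) (F : nat -> R -> 'rV[R]_4)
    (k1 k2 k3 r : R -> R) (N : 'rV[R]_3 -> 'rV[R]_4)
    (hj : (1 <= j <= 4)%N) (hlam : lam = 1 \/ lam = -1)
    (hI : open_interval I) (hW : open W) (hW0 : W !=set0)
    (hF : frenet_curve j I beta F k1 k2 k3)
    (hr : smooth_on I r) (hr_gt0 : forall s, I s -> 0 < r s)
    (hr' : forall s, I s -> lam * eps j 1 < (derive1 r s) ^+ 2)
    (hreg : regular_on (canal j lam beta F r) (param_domain I W))
    (hN : unit_normal_on (canal j lam beta F r) N (param_domain I W)) :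
  minimal_on (canal j lam beta F r) N (param_domain I W) <->
  (forall s, I s -> k1 s = 0) /\ integral_relation (eps j 1 * lam) I r.
Proof.
have [_ oI _] := hI; rewrite [eps j 1 * lam]mulrC.
have minP := minimal_canalP hj hlam oI hW hW0 hF hr hr_gt0 hr' hreg hN.
split=> [/minP eqs|[k0 rel]].
  split=> [s /eqs[]//|]; apply: radius_ode_integral_relation => // s.
  by move=> /eqs[].
apply/minP => s Is; split; first exact: k0.
exact: (integral_relation_radius_ode hI hr hr_gt0 hr' rel Is).
Qed.
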